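(* Let $R$ be a unital ring and $a,b,c\in R$. Then the following are equivalent: (1) $a$ is $(b,c)$-invertible; (2) $b$ and $c$ are regular, ${}^{\circ}c={}^{\circ}(cab)$, $R=Rc\oplus {}^{\circ}(ab)$ and $Rb=Rab$; (3) $b$ and $c$ are regular, $b^{\circ}=(cab)^{\circ}$, $R=bR\oplus (ca)^{\circ}$ and $cR=caR$; (4) $cab$ is regular, $Rc\subseteq Rb(cab)^-c$ for every inner inverse $(cab)^-$ of $cab$, $R=Rc\oplus {}^{\circ}(ab)$ and $Rb=Rab$; (5) $cab$ is regular, $bR\subseteq b(cab)^-cR$ for every inner inverse $(cab)^-$ of $cab$, $R=bR\oplus (ca)^{\circ}$ and $cR=caR$.
   Context: For $x\in R$: $xR=\{xr\mid r\in R\}$, $Rx=\{rx\mid r\in R\}$, ${}^{\circ}x=\{r\in R\mid rx=0\}$, $x^{\circ}=\{r\in R\mid xr=0\}$. An element $w\in R$ is regular (written $w\in R^-$) if there exists $z\in R$ with $wzw=w$; any such $z$ is called an inner inverse of $w$ and denoted $w^-$. The symbol $\oplus$ denotes the internal direct sum of one-sided ideals (sum equal to $R$, intersection $\{0\}$). For $a,b,c\in R$, an element $y\in R$ is the $(b,c)$-inverse of $a$ if $y\in (bRy)\cap (yRc)$, $yab=b$ and $cay=c$, where $bRy=\{bry\mid r\in R\}$ and $yRc=\{yrc\mid r\in R\}$; such $y$ is unique if it exists, and then $a$ is called $(b,c)$-invertible. *)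

(* Defs.v *)
From mathcomp Require Import all_boot all_algebra.
From mathcomp Require Import classical_sets.

Set Implicit Arguments.
Unset Strict Implicit.
Unset Printing Implicit Defensive.

Import GRing.Theory.
Local Open Scope classical_set_scope.
Local Open Scope ring_scope.

Section BCInverse.
(* pzRingType: unital associative rings, not assumed commutative or nonzero. *)
Variable R : pzRingType.
Implicit Types (a b c w x y z : R) (A B : set R).

Definition right_ideal_of x : set R := [set x * r | r in [set: R]].
Definition left_ideal_of x : set R := [set r * x | r in [set: R]].

Definition left_annihilator x : set R := [set r | r * x = 0].
Definition right_annihilator x : set R := [set r | x * r = 0].

Definition sandwich x y : set R := [set x * r * y | r in [set: R]].

Definition inner_inverse w z : Prop := w * z * w = w.
Definition regular w : Prop := exists z, inner_inverse w z.

(* R = A (+) B; only applied below to one-sided ideals on the same side. *)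
Definition ring_direct_sum A B : Prop :=
  [set u + v | u in A & v in B] = [set: R] /\ A `&` B = [set 0].

Definition bc_inverse a b c y : Prop :=
  [/\ (sandwich b y `&` sandwich y c) y, y * a * b = b & c * a * y = c].
Definition bc_invertible a b c : Prop := exists y, bc_inverse a b c y.

End BCInverse.

(* Main.v *)
Require Import Defs.
From mathcomp Require Import all_boot all_algebra.
From mathcomp Require Import classical_sets.

Import GRing.Theory.
Local Open Scope classical_set_scope.
Local Open Scope ring_scope.

(** Everything reduces to the element [c * a * b].  By
    [bc_invertible_factorP], [a] is [(b, c)]-invertible exactly when
    [b] is a left multiple and [c] a right multiple of it,
    [b = u * (c * a * b)] and [c = c * a * b * v]; the inverse is then
    [y = u * c = b * v].

    The conditions on left ideals supply these two factorizations
    ([bc_invertible_of_left_sum]).  Writing [1 = s * c + t] with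
    [t * (a * b) = 0] gives [a * b = s * (c * a * b)], and
    [R b = R a b] turns this into the factorization of [b].  If [g] is an
    inner inverse of [c * a * b], then [c - c * a * b * g * c] lies in [R c]
    and is killed by [a * b] on the right; directness makes it zero, which is
    the factorization of [c].  When only [b] is known to be regular, with
    inner inverse [z], the factorization [b = u * (c * a * b)] shows that
    [z * u] is an inner inverse of [c * a * b].
    Conversely, all the listed properties can be read off [u], [v] and [y].

    The conditions on right ideals are those on left ideals in the converse
    ring [R^c], with [b] and [c] exchanged, and [(b, c)]-invertibility is
    invariant under this exchange ([bc_invertible_converse]). *)

(** From the factorizations, [y = u * c] also equals [b * v], both being
    [u * (c * a * b) * v].  The first form gives [y * a * b = b], the second
    [c * a * y = c]; hence [y = y * a * y], and substituting [b * v] for the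
    left [y] or [u * c] for the right one puts [y] in [b R y] and [y R c]. *)
Lemma bc_invertible_factorP (R : pzRingType) (a b c : R) :
  bc_invertible a b c <->
  exists u v, b = u * (c * a * b) /\ c = c * a * b * v.
Proof.
split=> [[y [[[r _ yl] [s _ yr]] yab cay]]|[u [v [bE cE]]]].
  exists (y * s), (r * y); split.
    by rewrite !mulrA yr yab.
  by rewrite -[c * a * b * _]mulrA [b * _]mulrA yl cay.
have ucE : u * c = b * v by rewrite [in LHS]cE mulrA -bE.
have yab : u * c * a * b = b by rewrite -!mulrA [c * _]mulrA -bE.
have cay : c * a * (u * c) = c by rewrite ucE mulrA -cE.
have yay : u * c * a * (u * c) = u * c by rewrite -2!mulrA [c * _]mulrA cay.
exists (u * c); split=> //; split.
  by exists (v * a) => //; rewrite [b * _]mulrA -ucE yay.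
by exists (a * u) => //; rewrite -mulrA -[a * u * c]mulrA mulrA yay.
Qed.

Lemma bc_invertible_converse (R : pzRingType) (a b c : R) :
  @bc_invertible R^c a c b <-> bc_invertible a b c.
Proof.
rewrite !bc_invertible_factorP; split=> -[u [v]].
  by move=> [cE bE]; exists v, u; rewrite -[c * a * b]mulrA.
by move=> [bE cE]; exists v, u; move: bE cE; rewrite -[c * a * b]mulrA.
Qed.

Lemma inner_inverse_converse (R : pzRingType) (w z : R) :
  @inner_inverse R^c w z <-> inner_inverse w z.
Proof. by rewrite /inner_inverse -[w * z * w]mulrA. Qed.

Lemma regular_converse (R : pzRingType) (w : R) :
  @regular R^c w <-> regular w.
Proof. by split=> -[z /inner_inverse_converse wz]; exists z. Qed.

Lemma left_factor_of_sum (R : pzRingType) (a b c : R) :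
  ring_direct_sum (left_ideal_of c) (left_annihilator (a * b)) ->
  left_ideal_of b = left_ideal_of (a * b) ->
  exists u, b = u * (c * a * b).
Proof.
move=> [sumT _] RbE.
have [_ [s _ <-] [t /= tab0 E1]] :
    [set u + v | u in left_ideal_of c & v in left_annihilator (a * b)] 1.
  by rewrite sumT.
have [r _ rab] : left_ideal_of (a * b) b.
  by rewrite -RbE; exists 1; rewrite ?mul1r.
exists (r * s).
rewrite -[LHS]rab -[a * b in LHS]mul1r -E1 mulrDl tab0 addr0.
by rewrite !mulrA.
Qed.

Lemma bc_invertible_of_left_sum (R : pzRingType) (a b c : R) :
  regular (c * a * b) ->
  ring_direct_sum (left_ideal_of c) (left_annihilator (a * b)) ->
  left_ideal_of b = left_ideal_of (a * b) ->
  bc_invertible a b c.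
Proof.
move=> [g gE] sumR RbE; apply/bc_invertible_factorP.
have [u bE] := left_factor_of_sum _ _ _ _ sumR RbE.
exists u, (g * c); split=> //.
have : (left_ideal_of c `&` left_annihilator (a * b)) (c - c * a * b * g * c).
  split; first by exists (1 - c * a * b * g); rewrite // mulrBl mul1r.
  rewrite /left_annihilator /= mulrBl mulrA -[_ * c * (a * b)]mulrA.
  by rewrite [c * (a * b)]mulrA gE subrr.
by rewrite (proj2 sumR) /= => /eqP; rewrite subr_eq0 mulrA => /eqP.
Qed.

Section LeftConsequences.
Variables (R : pzRingType) (a b c : R).
Hypothesis inv_a : bc_invertible a b c.

Lemma bc_invertible_regular :
  [/\ regular b, regular c & regular (c * a * b)].
Proof.
have /bc_invertible_factorP [u [v [bE cE]]] := inv_a.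
have ucE : u * c = b * v by rewrite [in LHS]cE mulrA -bE.
split.
- by exists (v * a); rewrite /inner_inverse mulrA -ucE -!mulrA [c * _]mulrA -bE.
- by exists (a * u); rewrite /inner_inverse !mulrA -mulrA ucE mulrA -cE.
exists (v * a * u); rewrite /inner_inverse !mulrA -cE.
have -> : c * a * u * c * a * b = c * a * (u * (c * a * b)) by rewrite !mulrA.
by rewrite -bE.
Qed.

Lemma bc_invertible_left_annihilator :
  left_annihilator c = left_annihilator (c * a * b).
Proof.
have /bc_invertible_factorP [u [v [_ cE]]] := inv_a.
apply/seteqP; split=> x x0; rewrite /left_annihilator /=.
  by rewrite !mulrA x0 !mul0r.
by rewrite cE mulrA x0 mul0r.
Qed.

Lemma bc_invertible_left_ideal : left_ideal_of b = left_ideal_of (a * b).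
Proof.
have /bc_invertible_factorP [u [v [bE _]]] := inv_a.
apply/seteqP; split=> x [r _ <-].
  by exists (r * u * c) => //; rewrite [in RHS]bE !mulrA.
by exists (r * a); rewrite // mulrA.
Qed.

(** The projection onto [R c] along the annihilator is right multiplication
    by the idempotent [a * y], where [y = u * c] is the inverse: [a * y] lies
    in [R c], and [1 - a * y] kills [a * b] because [y * a * b = b]. *)
Lemma bc_invertible_left_sum :
  ring_direct_sum (left_ideal_of c) (left_annihilator (a * b)).
Proof.
have annE := bc_invertible_left_annihilator.
have /bc_invertible_factorP [u [v [bE _]]] := inv_a.
split; apply/seteqP; split=> // x.
- move=> _; exists (x * (a * u) * c); first by exists (x * (a * u)).
  exists (x - x * (a * u) * c); last by rewrite addrC subrK.
  rewrite /left_annihilator /= mulrBl.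
  have -> : x * (a * u) * c * (a * b) = x * (a * (u * (c * a * b))).
    by rewrite !mulrA.
  by rewrite -bE subrr.
- move=> [[r _ <-] /= rcab0].
  suff : left_annihilator c r by [].
  by rewrite annE /left_annihilator /= -rcab0 !mulrA.
by move=> ->; split; [exists 0; rewrite ?mul0r | exact: mul0r].
Qed.

Lemma bc_invertible_left_ideal_inner (g : R) :
  inner_inverse (c * a * b) g -> left_ideal_of c `<=` left_ideal_of (b * g * c).
Proof.
have /bc_invertible_factorP [u [v [_ cE]]] := inv_a.
move=> gE _ [r _ <-]; exists (r * (c * a)) => //.
(* Left multiplication by [c * a * b * g] fixes [c * a * b], hence also its
   right multiple [c]. *)
have cgE : c * a * b * g * c = c.
  by rewrite [X in _ * g * X]cE [LHS]mulrA gE -cE.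
by rewrite -[in RHS]cgE !mulrA.
Qed.

End LeftConsequences.

Lemma bc_invertible_left_annihilatorP (R : pzRingType) (a b c : R) :
  bc_invertible a b c <->
  [/\ regular b /\ regular c,
      left_annihilator c = left_annihilator (c * a * b),
      ring_direct_sum (left_ideal_of c) (left_annihilator (a * b)) &
      left_ideal_of b = left_ideal_of (a * b)].
Proof.
split=> [inv_a|[[[z bz] _] _ sumR RbE]].
  have [rb rc _] := bc_invertible_regular _ _ _ _ inv_a.
  split; first by split.
  - exact: bc_invertible_left_annihilator.
  - exact: bc_invertible_left_sum.
  - exact: (bc_invertible_left_ideal _ _ _ _ inv_a).
apply: bc_invertible_of_left_sum => //.
have [u bE] := left_factor_of_sum _ _ _ _ sumR RbE.
exists (z * u).
by rewrite /inner_inverse -mulrA -[z * u * _]mulrA -bE -!mulrA [b * _]mulrA bz.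
Qed.

Lemma bc_invertible_left_innerP (R : pzRingType) (a b c : R) :
  bc_invertible a b c <->
  [/\ regular (c * a * b),
      forall g : R, inner_inverse (c * a * b) g ->
        left_ideal_of c `<=` left_ideal_of (b * g * c),
      ring_direct_sum (left_ideal_of c) (left_annihilator (a * b)) &
      left_ideal_of b = left_ideal_of (a * b)].
Proof.
split=> [inv_a|[rcab _ sumR RbE]]; last exact: bc_invertible_of_left_sum.
have [_ _ rcab] := bc_invertible_regular _ _ _ _ inv_a.
split=> //.
- exact: bc_invertible_left_ideal_inner.
- exact: bc_invertible_left_sum.
- exact: (bc_invertible_left_ideal _ _ _ _ inv_a).
Qed.

Lemma bc_invertible_right_annihilatorP (R : pzRingType) (a b c : R) :
  bc_invertible a b c <->
  [/\ regular b /\ regular c,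
      right_annihilator b = right_annihilator (c * a * b),
      ring_direct_sum (right_ideal_of b) (right_annihilator (c * a)) &
      right_ideal_of c = right_ideal_of (c * a)].
Proof.
rewrite -bc_invertible_converse bc_invertible_left_annihilatorP.
rewrite -[c * a * b]mulrA.
split=> -[[/regular_converse rb /regular_converse rc] annE sumR idE].
  by split.
by split.
Qed.

Lemma bc_invertible_right_innerP (R : pzRingType) (a b c : R) :
  bc_invertible a b c <->
  [/\ regular (c * a * b),
      forall g : R, inner_inverse (c * a * b) g ->
        right_ideal_of b `<=` right_ideal_of (b * g * c),
      ring_direct_sum (right_ideal_of b) (right_annihilator (c * a)) &
      right_ideal_of c = right_ideal_of (c * a)].
Proof.
rewrite -bc_invertible_converse bc_invertible_left_innerP.
rewrite -[c * a * b]mulrA.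
split=> -[/regular_converse rcab sub sumR idE]; split=> // g /inner_inverse_converse /sub.
  by rewrite -[b * g * c]mulrA.
by rewrite -[b * g * c]mulrA.
Qed.

Theorem theorem3p10 (R : pzRingType) (a b c : R) :
  [<-> bc_invertible a b c;
       [/\ regular b /\ regular c,
           left_annihilator c = left_annihilator (c * a * b),
           ring_direct_sum (left_ideal_of c) (left_annihilator (a * b)) &
           left_ideal_of b = left_ideal_of (a * b)];
       [/\ regular b /\ regular c,
           right_annihilator b = right_annihilator (c * a * b),
           ring_direct_sum (right_ideal_of b) (right_annihilator (c * a)) &
           right_ideal_of c = right_ideal_of (c * a)];
       [/\ regular (c * a * b),
           forall g : R, inner_inverse (c * a * b) g ->
             left_ideal_of c `<=` left_ideal_of (b * g * c),
           ring_direct_sum (left_ideal_of c) (left_annihilator (a * b)) &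
           left_ideal_of b = left_ideal_of (a * b)];
       [/\ regular (c * a * b),
           forall g : R, inner_inverse (c * a * b) g ->
             right_ideal_of b `<=` right_ideal_of (b * g * c),
           ring_direct_sum (right_ideal_of b) (right_annihilator (c * a)) &
           right_ideal_of c = right_ideal_of (c * a)]].
Proof.
tfae.
- by move/bc_invertible_left_annihilatorP.
- by move/bc_invertible_left_annihilatorP/bc_invertible_right_annihilatorP.
- by move/bc_invertible_right_annihilatorP/bc_invertible_left_innerP.
- by move/bc_invertible_left_innerP/bc_invertible_right_innerP.
- by move/bc_invertible_right_innerP.
Qed.
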